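(* For every $k\in\mathbb N$ the space $\mathcal P_k(\mathbb R^n)$ has the direct sum decomposition $$\mathcal P_k(\mathbb R^n)=\bigoplus_{i=0}^k\left(X_{[n]}^q\right)^i\mathcal M_{k-i}^q(\mathbb R^n).$$
   Context: Let $q$ be a nonzero complex number with $|q|\neq1$ (fix a logarithm of $q$ to define $q^a$ for real $a$). $\mathcal P_k(\mathbb R^n)$ is the space of complex-valued homogeneous polynomials of degree $k$ in $x_1,\dots,x_n$. Fix $\mu_1,\dots,\mu_n>0$, $\gamma_i=\mu_i+\frac12$. Let $r_i$ be the substitution $x_i\mapsto-x_i$ and $T_{q,i}^{s}$ the substitution $x_i\mapsto q^sx_i$, and $$D_i^q=\frac{q^{\mu_i}}{q-q^{-1}}\,\frac{T_{q,i}-r_i}{x_i}-\frac{q^{-\mu_i}}{q-q^{-1}}\,\frac{T_{q,i}^{-1}-r_i}{x_i}.$$ Further $$D_{[n]}^q=\sum_{i=1}^nD_i^qR_{[n],i}^q,\quad X_{[n]}^q=\sum_{i=1}^nx_iR_{[n],i}^q,\quad R^q_{[n],i}=\Big(\prod_{j<i}q^{-\gamma_j/2}T_{q,j}^{-1/2}\Big)\Big(\prod_{i<j\le n}q^{\gamma_j/2}T_{q,j}^{1/2}r_j\Big),$$ and $\mathcal M_k^q(\mathbb R^n)=\ker(D_{[n]}^q)\cap\mathcal P_k(\mathbb R^n)$ is the space of $q$-Dunkl monogenics of degree $k$. *)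

(* Defs.v *)
From HB Require Import structures.
From mathcomp Require Import all_boot all_order all_algebra.
From mathcomp Require Import complex.
From mathcomp Require Import reals sequences exp trigo.
From mathcomp Require Import mpoly.

Set Implicit Arguments.
Unset Strict Implicit.
Unset Printing Implicit Defensive.

Import Order.TTheory GRing.Theory Num.Theory.
Local Open Scope ring_scope.
Local Open Scope complex_scope.

Definition cexp (R : realType) (z : R[i]) : R[i] :=
  let: x +i* y := z in (expR x * cos y) +i* (expR x * sin y).

(* [q ^ a] for real [a], where [l] is the chosen logarithm of [q]. *)
Definition qpow (R : realType) (l : R[i]) (a : R) : R[i] := cexp (a%:C * l).

Definition subst_scale (K : fieldType) (n : nat) (i : 'I_n) (c : K)
    (p : {mpoly K[n]}) : {mpoly K[n]} :=
  p \mPo [tuple (if j == i then c *: 'X_j else 'X_j) | j < n].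

(* Division by x_i.  Monomials not involving x_i are dropped, so this is a
   genuine quotient only on multiples of x_i; [mdivX_subst_scaleB] below
   shows that this is the case wherever it is used. *)
Definition mdivX (K : fieldType) (n : nat) (i : 'I_n) (p : {mpoly K[n]}) :
    {mpoly K[n]} :=
  \sum_(m <- msupp p | m i != 0%N) p@_m *: 'X_[(m - U_(i))%MM].

Lemma subst_scaleE (K : fieldType) (n : nat) (i : 'I_n) (c : K)
    (p : {mpoly K[n]}) :
  subst_scale i c p = \sum_(m <- msupp p) (p@_m * c ^+ m i) *: 'X_[m].
Proof.
rewrite /subst_scale comp_mpolyE; apply: eq_bigr => m _.
rewrite -scalerA; congr (_ *: _).
rewrite [in RHS]mpolyXE_id (bigD1 i) //= [in RHS](bigD1 i) //= tnth_mktuple eqxx.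
rewrite exprZn scalerAl; congr (_ * _); apply: eq_bigr => j /negPf ji.
by rewrite tnth_mktuple ji.
Qed.

Lemma mdivXK (K : fieldType) (n : nat) (i : 'I_n) (p : {mpoly K[n]}) :
  (forall m : 'X_{1..n}, m i = 0%N -> p@_m = 0) -> 'X_i * mdivX i p = p.
Proof.
move=> p0; rewrite [RHS]mpolyE /mdivX mulr_sumr big_mkcond /=.
apply: eq_bigr => m _; case: eqP => [/p0 -> | mi] /=; first by rewrite scale0r.
rewrite -scalerAr -mpolyXD; congr (_ *: 'X_[_]).
by rewrite addmC submK // lep1mP; apply/eqP.
Qed.

Lemma mdivX_subst_scaleB (K : fieldType) (n : nat) (i : 'I_n) (c d : K)
    (p : {mpoly K[n]}) :
  'X_i * mdivX i (subst_scale i c p - subst_scale i d p) =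
  subst_scale i c p - subst_scale i d p.
Proof.
apply: mdivXK => m mi; rewrite !subst_scaleE mcoeffB !raddf_sum -big_split.
rewrite big1 //= => m' _; rewrite !mcoeffZ mcoeffX.
by case: eqP => [->|_]; rewrite ?mulr0 ?subrr // mi !expr0 subrr.
Qed.

(* The operator T_{q,i}^s, for real s. *)
Definition qshift (R : realType) (l : R[i]) (n : nat) (i : 'I_n) (s : R) :
    {mpoly R[i][n]} -> {mpoly R[i][n]} :=
  subst_scale i (qpow l s).

Definition refl (R : realType) (n : nat) (i : 'I_n) :
    {mpoly R[i][n]} -> {mpoly R[i][n]} :=
  subst_scale i (-1).

Definition qDunkl (R : realType) (q l : R[i]) (n : nat) (mu : 'I_n -> R)
    (i : 'I_n) (p : {mpoly R[i][n]}) : {mpoly R[i][n]} :=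
  (qpow l (mu i) / (q - q^-1)) *: mdivX i (qshift l i 1 p - refl i p)
  - (qpow l (- mu i) / (q - q^-1)) *: mdivX i (qshift l i (-1) p - refl i p).

Definition qgamma (R : realType) (n : nat) (mu : 'I_n -> R) (i : 'I_n) : R :=
  mu i + 2^-1.

(* The products are compositions of operators, which commute. *)
Definition qtwist (R : realType) (l : R[i]) (n : nat) (mu : 'I_n -> R)
    (i : 'I_n) : {mpoly R[i][n]} -> {mpoly R[i][n]} :=
  (\big[comp/id]_(j < n | (j < i)%N)
     (fun p => qpow l (- (qgamma mu j / 2)) *: qshift l j (- 2^-1) p))
  \o
  (\big[comp/id]_(j < n | (i < j)%N)
     (fun p => qpow l (qgamma mu j / 2) *: qshift l j 2^-1 (refl j p))).

Definition qDirac (R : realType) (q l : R[i]) (n : nat) (mu : 'I_n -> R)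
    (p : {mpoly R[i][n]}) : {mpoly R[i][n]} :=
  \sum_(i < n) qDunkl q l mu i (qtwist l mu i p).

Definition qX (R : realType) (l : R[i]) (n : nat) (mu : 'I_n -> R)
    (p : {mpoly R[i][n]}) : {mpoly R[i][n]} :=
  \sum_(i < n) 'X_i * qtwist l mu i p.

Definition homogeneous (K : fieldType) (n k : nat) (p : {mpoly K[n]}) : Prop :=
  p \is k.-homog.

Definition qmonogenic (R : realType) (q l : R[i]) (n : nat) (mu : 'I_n -> R)
    (k : nat) (p : {mpoly R[i][n]}) : Prop :=
  qDirac q l mu p = 0 /\ homogeneous k p.

Definition op_image (V : Type) (f : V -> V) (U : V -> Prop) (v : V) : Prop :=
  exists2 u, U u & v = f u.

(* Internal direct sum of subspaces: every element of [W] is a sum of elements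
   of the [U i], every such sum is in [W], and the summands are unique. *)
Definition direct_sum (V : zmodType) (I : finType) (W : V -> Prop)
    (U : I -> V -> Prop) : Prop :=
  (forall v, W v <->
     exists2 u : I -> V, (forall i, U i (u i)) & v = \sum_i u i) /\
  (forall u u' : I -> V,
     (forall i, U i (u i)) -> (forall i, U i (u' i)) ->
     \sum_i u i = \sum_i u' i -> forall i, u i = u' i).

(* Main.v *)
(* Let s = q^(1/2).  The twists R_i make the cross terms of DX + XD cancel:
   moving R_i past x_j and R_j past x_i produces factors whose product is -1.
   The diagonal terms telescope, so that DX + XD acts on P_k as the scalar
   (q^(k + Gamma) - q^-(k + Gamma)) / (s - s^-1) with Gamma = \sum_j gamma_j.
   Hence for u in M_j, D X^(i+1) u = c X^i u, where c is an alternating sum of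
   these scalars; up to a nonzero factor, with e = (-1)^(i+1) and A = j + Gamma,
     c = (q^(i+1) - e) (q^A + e q^(1 - A - (i+1))),
   which is nonzero because |q| <> 1 and Gamma > 0 when n > 0.  By induction on
   k, DX is then bijective on P_k, whence P_(k+1) = M_(k+1) (+) X P_k.  For
   n = 0 we have Gamma = 0 and this fails, but everything vanishes in positive
   degree. *)

Require Import Defs.
From HB Require Import structures.
From mathcomp Require Import all_boot all_order all_algebra.
From mathcomp Require Import complex.
From mathcomp Require Import reals sequences exp trigo.
From mathcomp Require Import mpoly ring.
Import Order.TTheory GRing.Theory Num.Theory.
Local Open Scope ring_scope.
Local Open Scope complex_scope.

Set Implicit Arguments.
Unset Strict Implicit.

(** * Choice over a finite index type *)

Lemma fin_choice (T : Type) (I : finType) (t0 : T) (Q : I -> T -> Prop) :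
  (forall i, exists t, Q i t) -> exists f : I -> T, forall i, Q i (f i).
Proof.
move=> H.
suff [f Hf] : exists f : I -> T, forall i, i \in enum I -> Q i (f i).
  by exists f => i; apply: Hf; rewrite mem_enum.
elim: (enum I) => [|i s [f Hf]]; first by exists (fun=> t0).
have [t Ht] := H i.
exists (fun j => if j == i then t else f j) => j; rewrite inE.
by case: eqP => [-> | _ /= /Hf].
Qed.

(** * Fischer decomposition for an abstract pair of operators *)

Section Fischer.
Variables (K : fieldType) (V : lmodType K) (D X : {linear V -> V}).
Variables (P : nat -> V -> Prop) (lam : nat -> K) (c : nat -> nat -> K).
Hypothesis P_linear : forall k a u v, P k u -> P k v -> P k (a *: u + v).
Hypothesis P_zero : forall k, P k 0.
Hypothesis D_deg0 : forall v, P 0 v -> D v = 0.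
Hypothesis D_deg : forall k v, P k.+1 v -> P k (D v).
Hypothesis X_deg : forall k v, P k v -> P k.+1 (X v).
Hypothesis DX_XD : forall k v, P k v -> D (X v) + X (D v) = lam k *: v.
Hypothesis c0 : forall j, c 0 j = 0.
Hypothesis cS : forall i j, c i.+1 j = lam (i + j) - c i j.
Hypothesis c_neq0 : forall i j, c i.+1 j != 0.

Let mono k v := D v = 0 /\ P k v.
Let layer k i := op_image (iter i X) (mono (k - i)).

Lemma iter_linearZ i a u : iter i X (a *: u) = a *: iter i X u.
Proof. by elim: i => //= i ->; rewrite linearZ. Qed.

Lemma iter_deg i j u : P j u -> P (i + j) (iter i X u).
Proof. by move=> Pu; elim: i => //= i IH; apply: X_deg. Qed.

Lemma P_sum k (I : Type) (r : seq I) (F : I -> V) :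
  (forall i, P k (F i)) -> P k (\sum_(i <- r) F i).
Proof.
move=> PF; elim/big_ind: _ => // x y Px Py.
by rewrite -[x]scale1r; apply: P_linear.
Qed.

Lemma layer_deg k (i : 'I_k.+1) v : layer k i v -> P k v.
Proof.
case=> u [_ Pu] ->; have := iter_deg i Pu.
by rewrite subnKC // -ltnS.
Qed.

Lemma mono_scale k a u : mono k u -> mono k (a *: u).
Proof.
move=> [Du Pu]; split; first by rewrite linearZ /= Du scaler0.
by rewrite -[a *: u]addr0; apply: P_linear.
Qed.

(** Induction on [i]: since X^(i+1) u has degree i + 1 + j, moving D past one more X contributes
    [lam (i.+1 + j)] and changes the sign of the previous constant, which is the recursion [cS]. *)
Lemma D_iterX i j u : mono j u ->
  D (iter i.+1 X u) = c i.+1 j *: iter i X u.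
Proof.
move=> [Du Pu]; elim: i => [|i IH].
  have := DX_XD Pu; rewrite Du linear0 addr0 /= => ->.
  by rewrite cS c0 subr0.
have := DX_XD (iter_deg i.+1 Pu).
rewrite IH linearZ /= -/(iter i.+1 X u) => /(canRL (addrK _)) ->.
by rewrite -scalerBl -cS.
Qed.

(** [lift ord0 i] is i + 1 and (k + 1) - (i + 1) = k - i, so layer i + 1 in degree k + 1 and layer i
    in degree k come from the same monogenics. D maps the former bijectively onto the latter, as the
    next three lemmas show. *)
Lemma layer_lift k (i : 'I_k.+1) v : layer k.+1 (lift ord0 i) v ->
  exists2 u, mono (k - i) u & v = iter i.+1 X u.
Proof. by rewrite /layer lift0 subSS. Qed.

Lemma layer_D k (i : 'I_k.+1) v : layer k.+1 (lift ord0 i) v -> layer k i (D v).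
Proof.
case/layer_lift=> u mu ->; rewrite (D_iterX i mu).
by exists (c i.+1 (k - i) *: u); [apply: mono_scale | rewrite iter_linearZ].
Qed.

Lemma layer_D_inj k (i : 'I_k.+1) v w :
  layer k.+1 (lift ord0 i) v -> layer k.+1 (lift ord0 i) w -> D v = D w -> v = w.
Proof.
case/layer_lift=> u mu ->; case/layer_lift=> u' mu' ->.
rewrite !(D_iterX i mu, D_iterX i mu') => /(scalerI (c_neq0 _ _)) E.
by rewrite !iterS E.
Qed.

Lemma layer_D_surj k (i : 'I_k.+1) v : layer k i v ->
  exists2 w, layer k.+1 (lift ord0 i) w & D w = v.
Proof.
case=> u mu ->; pose u' := (c i.+1 (k - i))^-1 *: u.
have mu' : mono (k - i) u' by apply: mono_scale.
exists (iter i.+1 X u'); first by exists u'; rewrite ?lift0 ?subSS.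
by rewrite (D_iterX i mu') iter_linearZ scalerA divff ?scale1r.
Qed.

Lemma direct_sum_fischer k :
  direct_sum (P k) (fun i : 'I_k.+1 => layer k i).
Proof.
elim: k => [|k [IHex IHinj]]; split.
- move=> v; split=> [Pv | [u Hu ->]]; last by apply: P_sum => i; apply: layer_deg.
  exists (fun=> v); last by rewrite big_ord1.
  by move=> i; rewrite ord1; exists v => //; split=> //; apply: D_deg0.
- by move=> u u' _ _; rewrite !big_ord1 => E i; rewrite ord1.
- move=> v; split=> [Pv | [u Hu ->]]; last by apply: P_sum => i; apply: layer_deg.
  (* D v is decomposed in degree k and each component is lifted through D to the next layer; what is
     left of v is killed by D and becomes layer 0. *)
  have /IHex[u Hu Dv] := D_deg Pv.
  have [w Hw] : exists w : 'I_k.+1 -> V, forall i,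
      layer k.+1 (lift ord0 i) (w i) /\ D (w i) = u i.
    by apply: (@fin_choice _ _ 0 (fun i x => layer k.+1 (lift ord0 i) x /\ D x = u i)) => i; have [w ? ?] := layer_D_surj (Hu i); exists w.
  exists (fun i => if unlift ord0 i is Some j then w j else v - \sum_j w j).
    move=> i; case: unliftP => [j -> | ->]; first by have [] := Hw j.
    exists (v - \sum_j w j) => //; split.
      rewrite linearB linear_sum /= Dv; apply/eqP; rewrite subr_eq0; apply/eqP.
      by apply: eq_bigr => j _; have [] := Hw j.
    rewrite addrC -scaleN1r; apply: P_linear => //; apply: P_sum => j.
    by have [/layer_deg] := Hw j.
  rewrite big_ord_recl unlift_none -[LHS](subrK (\sum_j w j)); congr (_ + _).
  by apply: eq_bigr => j _; rewrite liftK.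
- move=> u u' Hu Hu' E.
  (* D kills layer 0, so applying it to both sums reduces uniqueness of the higher layers to degree
     k; layer 0 then follows by cancellation. *)
  have E0 w : (forall i : 'I_k.+2, layer k.+1 i (w i)) ->
      D (\sum_i w i) = \sum_i D (w (lift ord0 i)).
    move=> Hw; rewrite big_ord_recl linearD linear_sum /=.
    by have [x [Dx _] ->] := Hw ord0; rewrite /= Dx add0r.
  have El i : u (lift ord0 i) = u' (lift ord0 i).
    apply: layer_D_inj => //.
    apply: (IHinj (fun i => D (u (lift ord0 i))) (fun i => D (u' (lift ord0 i)))).
    + by move=> j; apply: layer_D.
    + by move=> j; apply: layer_D.
    + by rewrite -!E0 // E.
  move=> i; case: (unliftP ord0 i) => [j -> | ->] //.
  move: E; rewrite big_ord_recl [X in _ = X -> _]big_ord_recl.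
  under eq_bigr do rewrite El.
  exact: addIr.
Qed.
End Fischer.

(** * Real powers of q and their moduli *)

Section QPower.
Variables (R : realType) (l : R[i]).

Lemma cexpD (z w : R[i]) : cexp (z + w) = cexp z * cexp w.
Proof.
case: z w => [a b] [c d]; rewrite /cexp /= expRD cosD sinD.
by apply/eqP; rewrite eq_complex /=; apply/andP; split; apply/eqP; ring.
Qed.

Lemma cexp0 : cexp 0 = 1 :> R[i].
Proof. by rewrite /cexp /= expR0 cos0 sin0 mulr1 mulr0. Qed.

Lemma norm_cexp (z : R[i]) : `|cexp z| = (expR (complex.Re z))%:C.
Proof.
case: z => [a b]; rewrite /cexp normc_def /=.
by rewrite !exprMn -mulrDr cos2Dsin2 mulr1 sqrtr_sqr gtr0_norm ?expR_gt0.
Qed.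

Lemma qpowD a b : qpow l (a + b) = qpow l a * qpow l b.
Proof. by rewrite /qpow rmorphD mulrDl cexpD. Qed.

Lemma qpow0 : qpow l 0 = 1.
Proof. by rewrite /qpow mul0r cexp0. Qed.

Lemma qpow1 : qpow l 1 = cexp l.
Proof. by rewrite /qpow mul1r. Qed.

Lemma qpow_neq0 a : qpow l a != 0.
Proof.
apply/negP => /eqP a0; have := qpowD a (- a).
by rewrite subrr qpow0 a0 mul0r; apply/eqP/oner_neq0.
Qed.

Lemma qpowN a : qpow l (- a) = (qpow l a)^-1.
Proof.
apply: (mulfI (qpow_neq0 a)).
by rewrite -qpowD subrr qpow0 divff ?qpow_neq0.
Qed.

Lemma qpow_natM a k : qpow l (a * k%:R) = qpow l a ^+ k.
Proof.
by elim: k => [|k IH]; rewrite ?mulr0 ?qpow0 // -natr1 mulrDr mulr1 qpowD IH exprSr.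
Qed.

Lemma qpow_sum (I : Type) (r : seq I) (P : pred I) (F : I -> R) :
  qpow l (\sum_(i <- r | P i) F i) = \prod_(i <- r | P i) qpow l (F i).
Proof. exact: (big_morph _ qpowD qpow0). Qed.

(** The modulus of q^a is exp(a Re l), and |q| != 1 means Re l != 0. *)
Lemma norm_qpow_inj a b :
  `|cexp l| != 1 -> `|qpow l a| = `|qpow l b| -> a = b.
Proof.
rewrite /qpow !norm_cexp => Hl; case=> /expR_inj.
have ReM c : complex.Re (c%:C * l) = c * complex.Re l.
  by case: (l) => x y /=; rewrite mul0r subr0.
rewrite !ReM; apply: mulIf; apply: contra Hl => /eqP ->.
by rewrite expR0.
Qed.

End QPower.

(** * Substitution, division and multiplication on coefficients *)

Section Coefficients.
Variables (K : fieldType) (n : nat).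
Implicit Types (p : {mpoly K[n]}) (m : 'X_{1..n}) (i : 'I_n).

Lemma mcoeff_subst_scale i c p m : (subst_scale i c p)@_m = c ^+ m i * p@_m.
Proof.
rewrite subst_scaleE [in RHS](mpolyE p) !raddf_sum mulr_sumr /=.
apply: eq_bigr => m' _; rewrite !mcoeffZ mcoeffX.
by case: eqP => [->|_]; rewrite ?mulr0 // !mulr1 mulrC.
Qed.

Lemma mcoeff_mdivX i p m : (mdivX i p)@_m = p@_(m + U_(i))%MM.
Proof.
(* Subtraction of multi-indices truncates at 0; it is undone by adding [U_(i)] only when x_i occurs
   in m'. *)
have H (m' : 'X_{1..n}) : m' i != 0%N -> (m' - U_(i) == m)%MM = (m' == m + U_(i))%MM.
  move=> m'i; have Hm' : (U_(i) <= m')%MM by rewrite lep1mP.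
  by apply/eqP/eqP => [<-|->]; rewrite ?(submK Hm') ?addmK.
rewrite [in RHS](mpolyE p) /mdivX !raddf_sum /= big_mkcond /=.
apply: eq_bigr => m' _; rewrite !mcoeffZ !mcoeffX.
have [m'0|/H -> //] := eqVneq (m' i) 0%N.
have [E|_] := eqVneq m' (m + U_(i))%MM; last by rewrite mulr0.
by move: m'0; rewrite E mnmDE mnm1E eqxx addn1.
Qed.

Lemma mcoeff_mdivX_subst_scaleB i c d p m :
  (mdivX i (subst_scale i c p - subst_scale i d p))@_m =
  (c ^+ (m i).+1 - d ^+ (m i).+1) * p@_(m + U_(i))%MM.
Proof.
by rewrite mcoeff_mdivX mcoeffB !mcoeff_subst_scale mnmDE mnm1E eqxx addn1 mulrBl.
Qed.

Lemma mcoeff_mulX i p m :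
  ('X_i * p)@_m = if m i == 0%N then 0 else p@_(m - U_(i))%MM.
Proof.
have [mi|mi] := eqVneq (m i) 0%N; last first.
  have Hm : (U_(i) <= m)%MM by rewrite lep1mP.
  by rewrite -{1}(submK Hm) addmC mulrC mcoeffMX.
apply/eqP; rewrite mcoeff_eq0; apply/negP => /msuppM_le /allpairsP[[a b]] /=.
rewrite msuppX inE => -[/eqP -> _ E]; move: mi.
by rewrite E mnmDE mnm1E eqxx add1n.
Qed.

(** Operators diagonal in the monomial basis compose by multiplying their eigenvalues. *)
Lemma mcoeff_big_comp (I : Type) (r : seq I) (Q : pred I) m
    (F : I -> {mpoly K[n]} -> {mpoly K[n]}) (f : I -> K) p :
  (forall j q, (F j q)@_m = f j * q@_m) ->
  ((\big[comp/id]_(j <- r | Q j) F j) p)@_m = (\prod_(j <- r | Q j) f j) * p@_m.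
Proof.
move=> Ff; elim: r p => [|j r IH] p; first by rewrite !big_nil mul1r.
by rewrite !big_cons; case: ifP => // _ /=; rewrite Ff IH mulrA.
Qed.

End Coefficients.

Lemma telescope_prod (A : comRingType) (n : nat) (x y : 'I_n -> A) :
  \sum_(i < n) (x i - y i) *
    \prod_(j < n) (if (j < i)%N then y j else if (i < j)%N then x j else 1)
  = \prod_(i < n) x i - \prod_(i < n) y i.
Proof.
(* the summand of index [i] is [F i - F i.+1] *)
pose F (k : nat) : A := \prod_(j < n) (if (j < k)%N then y j else x j).
have FE (i : 'I_n) : (x i - y i) *
    \prod_(j < n) (if (j < i)%N then y j else if (i < j)%N then x j else 1)
    = - (F i.+1 - F i).
  rewrite /F (bigD1 i) //= [X in - (X - _)](bigD1 i) //= [X in - (_ - X)](bigD1 i) //=.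
  rewrite !ltnn ltnSn mul1r.
  have -> : \prod_(j < n | j != i) (if (j < i.+1)%N then y j else x j) =
            \prod_(j < n | j != i) (if (j < i)%N then y j else x j).
    by apply: eq_bigr => j ji; rewrite ltnS leq_eqVlt (inj_eq val_inj) (negPf ji).
  have -> : \prod_(j < n | j != i)
              (if (j < i)%N then y j else if (i < j)%N then x j else 1) =
            \prod_(j < n | j != i) (if (j < i)%N then y j else x j).
    apply: eq_bigr => j ji; case: ltnP => // ij.
    by rewrite ltn_neqAle ij eq_sym (inj_eq val_inj) ji.
  ring.
under eq_bigr do rewrite FE.
rewrite sumrN -(big_mkord xpredT (fun k => F k.+1 - F k)) telescope_sumr // opprB.
by rewrite /F; congr (_ - _); apply: eq_bigr => j _; rewrite ?ltn0 ?ltn_ord.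
Qed.

(** * Scalars of the Dunkl operators and twists on monomials *)

Section SuperAnticommutator.
(* [s], [M j] and [G j] stand for q^(1/2), q^(mu_j) and q^(gamma_j / 2), so that
   the identities below are purely algebraic. *)
Variables (K : fieldType) (n : nat) (s : K) (M G : 'I_n -> K).
Implicit Types (p : {mpoly K[n]}) (m : 'X_{1..n}).
Let q := s ^+ 2.
Let h := s - s^-1.
Hypothesis s_neq0 : s != 0.
Hypothesis G_neq0 : forall j, G j != 0.
Hypothesis G_sqr : forall j, G j ^+ 2 = M j * s.
Hypothesis q_root : forall i, q ^+ i.+1 != (-1) ^+ i.+1.

(** The scalar in D_i x_i^a = [qDunkl_coef i a] x_i^(a-1). *)
Definition qDunkl_coef (i : 'I_n) (a : nat) : K :=
  M i / (q - q^-1) * (q ^+ a - (-1) ^+ a)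
  - (M i)^-1 / (q - q^-1) * (q ^- a - (-1) ^+ a).

(** The eigenvalue on x_j^a of the part of R_i acting on x_j; the sign comes from the reflection
    r_j. *)
Definition qtwist_factor (i j : 'I_n) (a : nat) : K :=
  let e := G j * s ^+ a in
  if (j < i)%N then e^-1 else if (i < j)%N then (-1) ^+ a * e else 1.

Definition qtwist_coef (i : 'I_n) (m : 'X_{1..n}) : K :=
  \prod_(j < n) qtwist_factor i j (m j).

Let q_neq0 : q != 0. Proof. by rewrite expf_neq0. Qed.

Let M_neq0 j : M j != 0.
Proof. by have := expf_neq0 2 (G_neq0 j); rewrite G_sqr mulf_eq0 negb_or => /andP[]. Qed.

Let q_add1_neq0 : q + 1 != 0.
Proof. by rewrite addr_eq0; apply: q_root 0%N. Qed.

Let q2_sub1_neq0 : q ^+ 2 - 1 != 0.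
Proof. by rewrite subr_eq0; have := q_root 1; rewrite sqrrN expr1n. Qed.

Let q_sub1_neq0 : s * s - 1 != 0.
Proof. by have := q2_sub1_neq0; rewrite subr_sqr_1 mulf_eq0 negb_or => /andP[]. Qed.

Lemma qDunkl_coef0 i : qDunkl_coef i 0 = 0.
Proof. by rewrite /qDunkl_coef !expr0 invr1 subrr !mulr0 subrr. Qed.

(** The terms (-1)^a of consecutive degrees cancel; (q + 1) / (q - q^-1) = s / h then turns M_i s
    into G_i^2. *)
Lemma qDunkl_coef_addS i a :
  qDunkl_coef i a.+1 + qDunkl_coef i a =
  h^-1 * (G i ^+ 2 * q ^+ a - (G i ^+ 2 * q ^+ a)^-1).
Proof.
rewrite /qDunkl_coef G_sqr !exprS.
have := expf_neq0 a q_neq0; have := q2_sub1_neq0; have := M_neq0 i.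
move: (q ^+ a) (M i) ((-1) ^+ a) => Q Mi e; rewrite /h /q => Mi0 q0 Q0.
by field; rewrite Q0 s_neq0 Mi0 q_sub1_neq0.
Qed.

(** The commutation factor of R_i with multiplication by x_j: R_i x_j = [qtwist_step i j] x_j
    R_i. *)
Definition qtwist_step (i j : 'I_n) : K :=
  if (j < i)%N then s^-1 else if (i < j)%N then - s else 1.

Lemma qtwist_factorS i j a :
  qtwist_factor i j a.+1 = qtwist_step i j * qtwist_factor i j a.
Proof.
rewrite /qtwist_factor /qtwist_step !exprS.
case: ifP => _; first by rewrite mulrCA invfM.
by case: ifP => _; rewrite ?mulr1 //; ring.
Qed.

Lemma qtwist_coefD i j m :
  qtwist_coef i (m + U_(j))%MM = qtwist_step i j * qtwist_coef i m.
Proof.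
rewrite /qtwist_coef (bigD1 j) //= [in RHS](bigD1 j) //= mulrA -qtwist_factorS.
rewrite mnmDE mnm1E eqxx addn1; congr (_ * _).
by apply: eq_bigr => k kj; rewrite mnmDE mnm1E eq_sym (negPf kj) addn0.
Qed.

Lemma qtwist_step_id i : qtwist_step i i = 1.
Proof. by rewrite /qtwist_step ltnn. Qed.

Lemma qtwist_step_mul i j : i != j -> qtwist_step i j * qtwist_step j i = -1.
Proof.
rewrite -(inj_eq val_inj) /qtwist_step => ij.
by case: ltngtP ij => //= _ _; rewrite ?mulrN ?mulNr ?mulVf ?divff.
Qed.

(** Squaring removes the reflection signs and leaves the product in [telescope_prod] for x_j = G_j^2
    q^(m_j) and y_j = x_j^-1. *)
Lemma qtwist_coef_sqr i m :
  qtwist_coef i m ^+ 2 =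
  \prod_(j < n) (let e := G j ^+ 2 * q ^+ m j in
    if (j < i)%N then e^-1 else if (i < j)%N then e else 1).
Proof.
rewrite /qtwist_coef -prodrXl; apply: eq_bigr => j _; rewrite /qtwist_factor /=.
have E : (G j * s ^+ m j) ^+ 2 = G j ^+ 2 * q ^+ m j.
  by rewrite exprMn -!exprM mulnC.
case: ifP => _; first by rewrite exprVn E.
by case: ifP => _; rewrite ?expr1n // exprMn E sqrr_sign mul1r.
Qed.

(** * Linearity and degree of D and X *)

Variables D X : {mpoly K[n]} -> {mpoly K[n]}.
Hypothesis mcoeff_D : forall p m, (D p)@_m =
  \sum_(i < n) qDunkl_coef i (m i).+1 * (qtwist_coef i m * p@_(m + U_(i))%MM).
Hypothesis mcoeff_X : forall p m, (X p)@_m =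
  \sum_(i < n) if m i == 0%N then 0 else
    qtwist_coef i (m - U_(i))%MM * p@_(m - U_(i))%MM.

Lemma D_linear : linear D.
Proof.
move=> a u v; apply/mpolyP => m; rewrite mcoeffD mcoeffZ !mcoeff_D.
rewrite mulr_sumr -big_split; apply: eq_bigr => i _ /=.
by rewrite mcoeffD mcoeffZ; ring.
Qed.

Lemma X_linear : linear X.
Proof.
move=> a u v; apply/mpolyP => m; rewrite mcoeffD mcoeffZ !mcoeff_X.
rewrite mulr_sumr -big_split; apply: eq_bigr => i _ /=.
by case: ifP => _; rewrite ?mulr0 ?addr0 // mcoeffD mcoeffZ; ring.
Qed.

Lemma homogeneousP k p :
  homogeneous k p <-> (forall m, mdeg m != k -> p@_m = 0).
Proof.
split=> [Hp m mk | H]; first exact: dhomog_nemf_coeff Hp mk.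
apply/dhomogP => m; rewrite mcoeff_msupp => pm.
by apply/eqP; apply: contraR pm => /H ->.
Qed.

Lemma homogeneous_D k p : homogeneous k.+1 p -> homogeneous k (D p).
Proof.
move=> /homogeneousP Hp; apply/homogeneousP => m mk; rewrite mcoeff_D.
by rewrite big1 // => i _; rewrite Hp ?mulr0 // mdegD mdeg1 addn1.
Qed.

Lemma D_deg0 p : homogeneous 0 p -> D p = 0.
Proof.
move=> /homogeneousP Hp; apply/mpolyP => m; rewrite mcoeff_D mcoeff0.
by rewrite big1 // => i _; rewrite Hp ?mulr0 // mdegD mdeg1 addn1.
Qed.

Lemma homogeneous_X k p : homogeneous k p -> homogeneous k.+1 (X p).
Proof.
move=> /homogeneousP Hp; apply/homogeneousP => m mk; rewrite mcoeff_X.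
rewrite big1 // => i _; case: ifP => // mi; rewrite Hp ?mulr0 //.
apply: contra mk => /eqP <-.
by rewrite -(@submK _ U_(i) m) ?lep1mP ?mi // mdegD mdeg1 addn1 addmK.
Qed.


(** * The anticommutator DX + XD *)

Definition Gsum : K := \prod_(j < n) G j ^+ 2.

Definition qanticomm (k : nat) : K :=
  h^-1 * (Gsum * q ^+ k - (Gsum * q ^+ k)^-1).

(** With x_j = G_j^2 q^(m_j) and y_j = x_j^-1, each summand is h^-1 (x_i - y_i) times the product in
    [telescope_prod], and the product of all x_j is [Gsum] q^(mdeg m). *)
Lemma qanticomm_diag m :
  \sum_(i < n) (qDunkl_coef i (m i).+1 + qDunkl_coef i (m i)) * qtwist_coef i m ^+ 2
  = qanticomm (mdeg m).
Proof.
rewrite /qanticomm mdegE (big_morph (fun a => q ^+ a) (exprD q) (expr0 q)).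
rewrite -big_split -prodfV -telescope_prod mulr_sumr; apply: eq_bigr => i _.
by rewrite qDunkl_coef_addS qtwist_coef_sqr mulrA.
Qed.

Lemma mcoeff_DX_XD p m :
  (D (X p) + X (D p))@_m
  = qanticomm (mdeg m) * p@_m.
Proof.
rewrite mcoeffD mcoeff_D mcoeff_X -qanticomm_diag mulr_suml.
(* [A i j] and [B i j] are the contributions to DX and XD in which D lowers x_i and X raises x_j;
   they are paired so that off-diagonal pairs cancel. *)
pose A i j := qDunkl_coef i (m i).+1 * (qtwist_coef i m *
  (if (m + U_(i))%MM j == 0%N then 0 else
    qtwist_coef j (m + U_(i) - U_(j))%MM * p@_(m + U_(i) - U_(j))%MM)).
pose B i j := if m j == 0%N then 0 else qtwist_coef j (m - U_(j))%MM *
  (qDunkl_coef i ((m - U_(j))%MM i).+1 *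
    (qtwist_coef i (m - U_(j))%MM * p@_(m - U_(j) + U_(i))%MM)).
transitivity (\sum_i \sum_j (A i j + B i j)).
  under [RHS]eq_bigr do rewrite big_split.
  rewrite big_split /=; congr (_ + _).
    by apply: eq_bigr => i _; rewrite mcoeff_X !mulr_sumr.
  rewrite exchange_big; apply: eq_bigr => j _; rewrite /B.
  by case: ifP => _; [rewrite big1 | rewrite mcoeff_D mulr_sumr].
apply: eq_bigr => i _; rewrite (bigD1 i) //= [X in _ + X]big1 ?addr0 => [|j ji].
  rewrite /A /B mnmDE mnm1E eqxx addn1 /= addmK.
  (* At m_i = 0 the XD term is absent, in agreement with [qDunkl_coef i 0] = 0. *)
  have [-> | mi] := eqVneq (m i) 0%N; first by rewrite qDunkl_coef0; ring.
  have Um : (U_(i) <= m)%MM by rewrite lep1mP.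
  have tm : qtwist_coef i (m - U_(i))%MM = qtwist_coef i m.
    by rewrite -{2}(submK Um) qtwist_coefD qtwist_step_id mul1r.
  rewrite submK // tm mnmBE mnm1E eqxx subn1 prednK ?lt0n //; ring.
rewrite /A /B mnmDE mnm1E [i == j]eq_sym (negPf ji) addn0.
have [_ | mj] := eqVneq (m j) 0%N; first by rewrite !mulr0 addr0.
have Um : (U_(j) <= m)%MM by rewrite lep1mP.
rewrite -(submK Um); move: (m - U_(j))%MM => m'.
rewrite -(addmA m') [(U_(j) + U_(i))%MM]addmC addmA !addmK.
rewrite mnmDE mnm1E (negPf ji) addn0 !qtwist_coefD.
set a := qtwist_coef i m'; set b := qtwist_coef j m'.
set d := qDunkl_coef _ _; set x := p@_ _.
(* The DX term differs from the XD term exactly by the two commutation factors, whose product is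
   -1. *)
transitivity ((qtwist_step j i * qtwist_step i j + 1) * (d * (a * (b * x)))).
  by ring.
by rewrite qtwist_step_mul // addNr mul0r.
Qed.

Lemma DX_XD k p : homogeneous k p ->
  D (X p) + X (D p) = qanticomm k *: p.
Proof.
move=> /homogeneousP Hp; apply/mpolyP => m; rewrite mcoeff_DX_XD mcoeffZ.
by have [-> // | /Hp ->] := eqVneq (mdeg m) k; rewrite !mulr0.
Qed.

(** Closed form of the alternating sum of [qanticomm (t + j)] over t < i, in which the last term has
    sign +. Here [Gsum * q ^+ j] stands for q^(j + Gamma). *)
Definition qlower_coef (i j : nat) : K :=
  (h * (q + 1))^-1 * ((q ^+ i - (-1) ^+ i) *
    (Gsum * q ^+ j + (-1) ^+ i * q / (Gsum * q ^+ j * q ^+ i))).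

Lemma Gsum_neq0 : Gsum != 0.
Proof. by apply/prodf_neq0 => j _; rewrite expf_neq0. Qed.

Lemma qlower_coef0 j : qlower_coef 0 j = 0.
Proof. by rewrite /qlower_coef !expr0 subrr mul0r mulr0. Qed.

Lemma qlower_coefS i j :
  qlower_coef i.+1 j = qanticomm (i + j) - qlower_coef i j.
Proof.
rewrite /qlower_coef /qanticomm exprD !exprS.
have := expf_neq0 i q_neq0; have := expf_neq0 j q_neq0; have := Gsum_neq0.
(* The sign depends only on the parity of i, so it becomes a boolean and the recursion splits into
   two rational identities. *)
rewrite -signr_odd; move: (q ^+ i) (q ^+ j) Gsum (odd i) => Q P g b g0 P0 Q0.
have := q_add1_neq0; rewrite /h /q => q1.
by case: b; rewrite ?expr0 ?expr1; field; rewrite Q0 P0 g0 s_neq0 q1 q_sub1_neq0.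
Qed.

(** The factor q^(i+1) - (-1)^(i+1) is nonzero by [q_root]; over a common denominator the other
    factor has as numerator the difference of the two sides of the assumption. *)
Lemma qlower_coef_neq0 i j :
  Gsum ^+ 2 * q ^+ (j + j + i) != (-1) ^+ i -> qlower_coef i.+1 j != 0.
Proof.
move=> H; have h_neq0 : h != 0.
  by rewrite (_ : h = (s * s - 1) / s) ?mulf_neq0 ?invr_eq0 // /h; field.
apply: mulf_neq0; first by rewrite invr_eq0; apply: mulf_neq0.
apply: mulf_neq0; first by rewrite subr_eq0.
have gP : Gsum * q ^+ j != 0 by rewrite mulf_neq0 ?expf_neq0 ?Gsum_neq0.
have Q0 := expf_neq0 i q_neq0.
rewrite (_ : _ + _ = (Gsum ^+ 2 * q ^+ (j + j + i) - (-1) ^+ i) /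
    (Gsum * q ^+ j * q ^+ i)); last first.
  move: gP; rewrite mulf_eq0 negb_or => /andP[]; rewrite !exprD !exprS.
  move: (q ^+ i) (q ^+ j) Gsum Q0 => Q P g Q0 g0 P0.
  by field; rewrite Q0 P0 g0.
by rewrite mulf_neq0 ?subr_eq0 // invr_eq0 mulf_neq0.
Qed.

Lemma direct_sum_qmonogenic k :
  (forall i j, Gsum ^+ 2 * q ^+ (j + j + i) != (-1) ^+ i) ->
  direct_sum (@homogeneous K n k)
    (fun i : 'I_k.+1 =>
       op_image (iter i X) (fun p => D p = 0 /\ homogeneous (k - i) p)).
Proof.
move=> Gsum_q.
pose D' : {linear {mpoly K[n]} -> {mpoly K[n]}} :=
  HB.pack D (GRing.isLinear.Build _ _ _ _ D D_linear).
pose X' : {linear {mpoly K[n]} -> {mpoly K[n]}} :=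
  HB.pack X (GRing.isLinear.Build _ _ _ _ X X_linear).
apply: (@direct_sum_fischer _ _ D' X' (@homogeneous K n) qanticomm qlower_coef).
- by move=> d a u v Hu Hv; apply: dhomogD => //; apply: dhomogZ.
- by move=> d; apply: dhomog0.
- exact: D_deg0.
- exact: homogeneous_D.
- exact: homogeneous_X.
- by move=> d v; apply: DX_XD.
- exact: qlower_coef0.
- exact: qlower_coefS.
- by move=> i j; apply: qlower_coef_neq0.
Qed.

End SuperAnticommutator.

(** * Specialization to complex powers of q *)

Section ComplexPowers.
Variables (R : realType) (q l : R[i]) (n : nat) (mu : 'I_n -> R).
Hypotheses (q_norm : `|q| != 1) (l_log : cexp l = q).
Let C : fieldType := R[i].
Implicit Types (p : {mpoly C[n]}) (m : 'X_{1..n}).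

Let s : C := qpow l 2^-1.
Let M (j : 'I_n) : C := qpow l (mu j).
Let G (j : 'I_n) : C := qpow l (qgamma mu j / 2).

Lemma qpow1q : qpow l 1 = q.
Proof. by rewrite qpow1. Qed.

Lemma s_sqr : s ^+ 2 = q.
Proof. by rewrite -qpow1q /s -qpow_natM mulVf // pnatr_eq0. Qed.

Lemma half_exponent j a : G j * s ^+ a = qpow l ((qgamma mu j + a%:R) / 2).
Proof. by rewrite /G /s -qpow_natM -qpowD; congr (qpow _ _); field. Qed.

Lemma mcoeff_qDunkl i p m :
  (qDunkl q l mu i p)@_m = qDunkl_coef s M i (m i).+1 * p@_(m + U_(i))%MM.
Proof.
have lin (c d x y : C) (u v : {mpoly C[n]}) : u@_m = x -> v@_m = y ->
    (c *: u - d *: v)@_m = c * x - d * y.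
  by move=> <- <-; rewrite mcoeffB !mcoeffZ.
have E t : (mdivX i (qshift l i t p - refl i p))@_m =
    (qpow l t ^+ (m i).+1 - (-1) ^+ (m i).+1) * p@_(m + U_(i))%MM.
  exact: mcoeff_mdivX_subst_scaleB.
rewrite /qDunkl (lin _ _ _ _ _ _ (E 1) (E (-1))) (qpowN l 1).
rewrite qpow1q exprVn /qDunkl_coef s_sqr /M -qpowN.
ring.
Qed.

Lemma mcoeff_qtwist i p m :
  (qtwist l mu i p)@_m = qtwist_coef s G i m * p@_m.
Proof.
rewrite /qtwist /=.
rewrite (@mcoeff_big_comp _ _ _ _ _ _ _ (fun j => (G j * s ^+ m j)^-1)); last first.
  move=> j r; rewrite mcoeffZ mcoeff_subst_scale mulrA -qpow_natM -qpowD.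
  by rewrite half_exponent -qpowN; congr (qpow _ _ * _); field.
rewrite (@mcoeff_big_comp _ _ _ _ _ _ _
  (fun j => (-1) ^+ m j * (G j * s ^+ m j))); last first.
  by move=> j r; rewrite mcoeffZ !mcoeff_subst_scale /G /s; ring.
rewrite mulrA /qtwist_coef; congr (_ * _).
(* The products over j < i and j > i merge into one over all j, with factor 1 at j = i. *)
rewrite big_mkcond [X in _ * X]big_mkcond -big_split /=; apply: eq_bigr => j _.
by rewrite /qtwist_factor; case: ltngtP => _; rewrite ?mulr1 ?mul1r.
Qed.

(** The twist is evaluated at m + [U_(i)], but R_i does not act on x_i, so its eigenvalue there is
    the one at m. *)
Lemma mcoeff_qDirac p m : (qDirac q l mu p)@_m =
  \sum_(i < n) qDunkl_coef s M i (m i).+1 *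
    (qtwist_coef s G i m * p@_(m + U_(i))%MM).
Proof.
rewrite /qDirac raddf_sum; apply: eq_bigr => i _.
by rewrite /= mcoeff_qDunkl mcoeff_qtwist qtwist_coefD qtwist_step_id mul1r.
Qed.

Lemma mcoeff_qX p m : (qX l mu p)@_m =
  \sum_(i < n) if m i == 0%N then 0 else
    qtwist_coef s G i (m - U_(i))%MM * p@_(m - U_(i))%MM.
Proof.
rewrite /qX raddf_sum; apply: eq_bigr => i _.
by rewrite /= mcoeff_mulX; case: ifP; rewrite ?mcoeff_qtwist.
Qed.

Lemma direct_sum_with_variables k : (0 < n)%N -> (forall i, 0 < mu i) ->
  direct_sum (@homogeneous R[i] n k)
    (fun i : 'I_k.+1 =>
       op_image (iter i (qX l mu)) (qmonogenic q l mu (k - i))).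
Proof.
move=> n_gt0 mu_gt0.
have norm_exp : `|cexp l| != 1 by rewrite l_log.
have qE j : q ^+ j = qpow l j%:R by rewrite -[j%:R]mul1r qpow_natM qpow1q.
have norm_sign j : `|(-1) ^+ j : C| = `|qpow l 0|.
  by rewrite normrX normrN1 expr1n qpow0 normr1.
(* Signs have modulus 1 = |q^0|, so equality would force a = 0. *)
have qpow_sign a j : 0 < a -> qpow l a != (-1) ^+ j.
  move=> a0; apply/eqP => /(congr1 Num.norm); rewrite norm_sign.
  by move/(norm_qpow_inj norm_exp) => E; rewrite E ltxx in a0.
apply: (@direct_sum_qmonogenic C n s M G _ _ _ _ (qDirac q l mu) (qX l mu)).
- exact: qpow_neq0.
- by move=> j; apply: qpow_neq0.
- by move=> j; rewrite /G /M /s -qpow_natM -qpowD divfK // pnatr_eq0.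
- by move=> i; rewrite s_sqr qE qpow_sign // ltr0n.
- exact: mcoeff_qDirac.
- exact: mcoeff_qX.
(* The left side is q^(2 Gamma + 2j + i). Its exponent is positive because Gamma > 0, which is seen
   by isolating one variable. *)
- move=> i j; rewrite s_sqr qE /Gsum.
  under eq_bigr do rewrite /G -qpow_natM divfK ?pnatr_eq0 //.
  rewrite -qpow_sum -qpow_natM -qpowD qpow_sign //.
  have g0 k' : 0 < qgamma mu k' by rewrite addr_gt0 ?invr_gt0.
  rewrite ltr_wpDr // mulr_gt0 // (bigD1 (Ordinal n_gt0)) //=.
  by apply: ltr_wpDr => //; apply: sumr_ge0 => k' _; apply: ltW.
Qed.

End ComplexPowers.

(** * The case of no variables *)

Lemma direct_sum_no_variable (R : realType) (q l : R[i]) (mu : 'I_0 -> R) k :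
  direct_sum (@homogeneous R[i] 0 k)
    (fun i : 'I_k.+1 =>
       op_image (iter i (qX l mu)) (qmonogenic q l mu (k - i))).
Proof.
have X0 p : qX l mu p = 0 by rewrite /qX big_ord0.
have D0 p : qDirac q l mu p = 0 by rewrite /qDirac big_ord0.
case: k => [|k].
  split=> [v | u u' _ _]; last by rewrite !big_ord1 => E i; rewrite ord1.
  split=> [Hv | [u Hu ->]].
    exists (fun=> v); last by rewrite big_ord1.
    by move=> i; rewrite ord1; exists v.
  by rewrite big_ord1; have [w [_ Hw] ->] := Hu ord0.
have hom0 (p : {mpoly R[i][0]}) : homogeneous k.+1 p -> p = 0.
  move=> /homogeneousP Hp; apply/mpolyP => m; rewrite mcoeff0 Hp //.
  by rewrite mdegE big_ord0.
have layer0 (i : 'I_k.+2) v :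
    op_image (iter i (qX l mu)) (qmonogenic q l mu (k.+1 - i)) v -> v = 0.
  (* Layer 0 vanishes because there are no nonzero polynomials of positive degree, and the higher
     layers vanish because X = 0. *)
  case=> w [_ Hw] ->; case: i Hw => -[|i] /= _ Hw; last exact: X0.
  by apply: hom0; rewrite subn0 in Hw.
split=> [v | u u' Hu Hu' _ i].
  split=> [/hom0 -> | [u Hu ->]].
    exists (fun=> 0); last by rewrite big1.
    move=> i; exists 0; first by split; [exact: D0 | exact: dhomog0].
    by case: i => -[|i] //= _; rewrite X0.
  by rewrite big1 => [|i _]; [exact: dhomog0 | exact: layer0 (Hu i)].
by rewrite (layer0 _ _ (Hu i)) (layer0 _ _ (Hu' i)).
Qed.

Theorem proposition6 (R : realType) (q l : R[i]) (n : nat) (mu : 'I_n -> R)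
    (q_neq0 : q != 0) (q_norm : `|q| != 1) (l_log : cexp l = q)
    (mu_gt0 : forall i, 0 < mu i) (k : nat) :
  direct_sum (@homogeneous R[i] n k)
    (fun i : 'I_k.+1 =>
       op_image (iter i (qX l mu)) (qmonogenic q l mu (k - i))).
Proof.
case: n mu mu_gt0 => [|n] mu mu_gt0; first exact: direct_sum_no_variable.
exact: direct_sum_with_variables.
Qed.
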